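(* Let $N\ge2$ and let $\mathbf{d}=(d_1,\ldots,d_N)$ and $\mathbf{r}=(r_1,\ldots,r_N)$ be sequences of positive integers. Then the subspace variety $\mathrm{S}_{\mathbf{d},\mathbf{r}}$ is equal to a tree tensor network variety, $\mathrm{S}_{\mathbf{d},\mathbf{r}}=\mathrm{TTN}_{\mathscr{T},\mathbf{V},\mathbf{r}}$, where: (1) $\mathscr{T}$ is the rooted tree with leaves $\mathscr{L}=\{\lambda_1,\ldots,\lambda_N\}$, internal nodes $\mathscr{N}=\{\rho\}$, and edges $\{\lambda_i,\rho\}$ for $i=1,\ldots,N$; (2) $V_{\lambda_i}=\mathbb{C}^{d_i}$ and $r_{\lambda_i}=r_i$ for $i=1,\ldots,N$.
   Context: The subspace variety $\mathrm{S}_{\mathbf{d},\mathbf{r}}\subseteq\mathbb{P}\big(\bigotimes_{i=1}^N\mathbb{C}^{d_i}\big)$ is the Zariski closure of the set of classes $[\psi]$ of nonzero tensors of the form $$\psi_{j_1\cdots j_N}=\sum_{\alpha_1=1}^{r_1}\cdots\sum_{\alpha_N=1}^{r_N}C_{\alpha_1,\ldots,\alpha_N}A^1_{j_1,\alpha_1}\cdots A^N_{j_N,\alpha_N},$$ with arbitrary $A^i\in\mathbb{C}^{d_i}\otimes(\mathbb{C}^{r_i})^*$ and $C\in\bigotimes_{i=1}^N\mathbb{C}^{r_i}$. For a rooted tree $\mathscr{T}$ with root $\rho$, leaves $\mathscr{L}$ (vertices without children), internal nodes $\mathscr{N}=\mathscr{T}\setminus\mathscr{L}$, children sets $\mathrm{ch}(v)$,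 spaces $V_\lambda=\mathbb{C}^{d_\lambda}$ ($\lambda\in\mathscr{L}$) and positive integers $(r_v)_{v\in\mathscr{T}\setminus\{\rho\}}$ with $r_\rho:=1$, the variety $\mathrm{TTN}_{\mathscr{T},\mathbf{V},\mathbf{r}}\subset\mathbb{P}(\bigotimes_{\lambda\in\mathscr{L}}V_\lambda)$ is the set of $[\psi]$ such that for each vertex $v\in\mathscr{T}$ there is a linear subspace $U_v$ with $\dim U_v\le r_v$ satisfying: $U_\lambda\subseteq V_\lambda$ for $\lambda\in\mathscr{L}$; $U_v\subseteq\bigotimes_{u\in\mathrm{ch}(v)}U_u$ for $v\in\mathscr{N}$; and some representative $\psi$ of $[\psi]$ lies in $U_\rho$. *)

(* Defs.v *)
From HB Require Import structures.
From mathcomp Require Import all_boot all_order all_algebra.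
From mathcomp Require Import classical_sets reals complex.
From mathcomp Require Import mpoly.

Set Implicit Arguments.
Unset Strict Implicit.
Unset Printing Implicit Defensive.

Import GRing.Theory.
Local Open Scope ring_scope.
Local Open Scope classical_set_scope.

(* Coordinate space K^I, as a vectType. For I = 'I_d this is K^d; for
   I = {dffun forall i, J i} it is the tensor product of the spaces K^(J i),
   an element x having the coordinates x_(j_1 ... j_n). *)
Definition tensor (K : fieldType) (I : finType) := {ffun I -> K^o}.

(* A point of the projective space P(V) is a line of V; the class of a nonzero
   vector x is the line <[x]>. *)
Definition proj (K : fieldType) (V : vectType K) := {L : {vspace V} | \dim L == 1%N}.

Definition is_class (K : fieldType) (V : vectType K) (p : proj V) (x : V) : Prop :=
  x != 0 /\ val p = <[x]>%VS.

Section Zariski.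
Variables (K : fieldType) (I : finType).

(* The k-th variable is the coordinate of index enum_val k. *)
Definition coords (x : tensor K I) : 'I_#|I| -> K := fun k => x (enum_val k).

Definition zero_locus (F : set {mpoly K[#|I|]}) : set (proj (tensor K I)) :=
  [set p | forall f, F f -> forall x, is_class p x -> f.@[coords x] = 0].

Definition zariski_closed (Z : set (proj (tensor K I))) : Prop :=
  exists2 F : set {mpoly K[#|I|]},
    (forall f, F f -> exists e : nat, f \is e.-homog) & Z = zero_locus F.

Definition zariski_closure (S : set (proj (tensor K I))) : set (proj (tensor K I)) :=
  smallest zariski_closed S.

End Zariski.

Section SubspaceVariety.
Variables (K : fieldType) (N : nat) (d r : 'I_N -> nat).

Definition tucker (A : forall i, 'M[K]_(d i, r i))
    (C : tensor K {dffun forall i, 'I_(r i)}) : tensor K {dffun forall i, 'I_(d i)} :=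
  [ffun j : {dffun forall i, 'I_(d i)} =>
     \sum_(a : {dffun forall i, 'I_(r i)}) C a * \prod_i A i (j i) (a i)].

Definition subspace_variety : set (proj (tensor K {dffun forall i, 'I_(d i)})) :=
  zariski_closure [set p | exists A C, is_class p (tucker A C)].

End SubspaceVariety.

Arguments subspace_variety K {N} d r _.

Section TensorOfSubspaces.
Variables (K : fieldType) (n : nat) (J : 'I_n -> finType).

Definition pure (x : forall i, tensor K (J i)) : tensor K {dffun forall i, J i} :=
  [ffun j : {dffun forall i, J i} => \prod_i (x i (j i) : K)].

(* w lies in the tensor product of the subspaces U i, i.e. in the span of the
   pure tensors with factors in the U i. *)
Definition in_tensor (U : forall i, {vspace tensor K (J i)})
    (w : tensor K {dffun forall i, J i}) : Prop :=
  exists (m : nat) (c : 'I_m -> K) (x : 'I_m -> forall i, tensor K (J i)),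
    (forall k i, x k i \in U i) /\ w = \sum_k c k *: pure (x k).

End TensorOfSubspaces.

(* Rooted trees carrying the dimension d of V_lambda at each leaf lambda, and
   the integer r_v at each non-root vertex v; the latter is stored at the parent
   of v, so that the root has none. An internal node has at least one child. *)
Inductive rtree : Type :=
| Leaf (d : nat)
| Node (n : nat) (n_gt0 : (0 < n)%N) (r : 'I_n -> nat) (ch : 'I_n -> rtree).

(* Index set of the tensors over the leaves below the root of t, i.e. the product
   of the 'I_d over these leaves, bracketed along the tree. *)
Fixpoint idx (t : rtree) : finType :=
  match t with
  | Leaf d => 'I_d
  | Node n _ _ ch => {dffun forall i : 'I_n, idx (ch i)}
  end.

(* A choice of a subspace U_v for each vertex v of t. *)
Fixpoint family (K : fieldType) (t : rtree) : Type :=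
  match t with
  | Leaf d => {vspace tensor K (idx (Leaf d))}
  | Node n n_gt0 r ch =>
      ({vspace tensor K (idx (Node n_gt0 r ch))} * (forall i, family K (ch i)))%type
  end.

Definition root_space (K : fieldType) (t : rtree) :
    family K t -> {vspace tensor K (idx t)} :=
  match t with
  | Leaf _ => fun U => U
  | Node _ _ _ _ => fun U => U.1
  end.

(* The conditions on (U_v), s being the bound r_v at the root v of t. *)
Fixpoint compatible (K : fieldType) (t : rtree) (s : nat) : family K t -> Prop :=
  match t with
  | Leaf _ => fun U => (\dim U <= s)%N
  | Node n _ r ch => fun U =>
      [/\ (\dim U.1 <= s)%N,
          forall w, w \in U.1 -> in_tensor (fun i => root_space (U.2 i)) w
        & forall i, compatible (r i) (U.2 i)]
  end.

Definition TTN (K : fieldType) (t : rtree) : set (proj (tensor K (idx t))) :=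
  [set p | exists U : family K t, compatible 1 U /\
             exists2 psi, is_class p psi & psi \in root_space U].

Arguments TTN : clear implicits.

Definition star (N : nat) (N_gt0 : (0 < N)%N) (d r : 'I_N -> nat) : rtree :=
  Node N_gt0 r (fun i => Leaf (d i)).

(* Main.v *)
(* A tensor is of the form [tucker A C] if and only if, for every [i], its i-th
   flattening has rank at most [r i]. This is a determinantal condition, so these
   tensors already form a Zariski closed set and taking the closure adds nothing.
   For the converse, a matrix [M] of rank at most [r i] is fixed by some product
   [A i *m Q i] factoring through K^(r i); applying these products in all the modes
   gives [psi = tucker A (tucker Q psi)]. The same retractions, built from the
   subspaces [U_(lambda_i)] instead of the flattenings, show that a tensor of the
   star-shaped network has this form. *)
Require Import Defs.
From HB Require Import structures.
From mathcomp Require Import all_boot all_order all_algebra perm.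
From mathcomp Require Import classical_sets reals complex.
From mathcomp Require Import mpoly.

Set Implicit Arguments.
Unset Strict Implicit.
Unset Printing Implicit Defensive.

Local Open Scope ring_scope.
Import GRing.Theory.

(** * Dependent distributivity, minors and matrix retractions *)

Lemma prod_sum_dffun (K : comPzRingType) (I : finType) (J : I -> finType)
    (F : forall i, J i -> K) :
  \prod_i \sum_(j : J i) F i j
    = \sum_(f : {dffun forall i, J i}) \prod_i F i (f i).
Proof.
pose G i := [ffun j : J i => F i j].
(* Ordinary distributivity is about functions with a fixed codomain, so dependent functions are
   traded for families of tagged values. *)
rewrite (reindex (@dffun_of_fprod _ J)); last exact/onW_bij/dffun_of_fprod_bij.
transitivity (\sum_(t : fprod J) \prod_(i in I) G i (t i)); last first.
  by apply: eq_bigr => t _; apply: eq_bigr => i _; rewrite !ffunE.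
rewrite big_fprod.
rewrite -(bigA_distr_big_dep _ (fun i u => untag 0 (G i) u)).
by apply: eq_bigr => i _; rewrite -(big_tag G); apply: eq_bigr => j _; rewrite ffunE.
Qed.

(** If the rank exceeds [s], choosing [s.+1] independent rows and then [s.+1] independent columns of
    these gives an invertible submatrix. The selections [f] and [g] may repeat indices, which only
    adds zero minors. *)
Lemma rank_le_minorsP (K : fieldType) m n s (M : 'M[K]_(m, n)) :
  (\rank M <= s)%N <->
  forall (f : 'I_s.+1 -> 'I_m) (g : 'I_s.+1 -> 'I_n), \det (mxsub f g M) = 0.
Proof.
split=> [leMs f g | minors0].
  apply/eqP/contraT; rewrite -unitfE -unitmxE -row_full_unit => /eqP rk.
  suff: (s.+1 <= s)%N by rewrite ltnn.
  apply: leq_trans leMs; rewrite -[X in (X <= _)%N]rk -[M in mxsub f g M]mulmx1 mxsub_mul.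
  exact: leq_trans (mxrankM_maxl _ _) (mxrankS (rowsub_sub _ _)).
rewrite leqNgt; apply/negP => lt_s.
pose f := maxrankfun M \o widen_ord lt_s.
have free1 : row_free (rowsub f M).
  have /row_freeP[B MB] := maxrowsub_free M.
  apply/row_freeP; exists (colsub (widen_ord lt_s) B).
  rewrite /f rowsub_comp mulmx_colsub mul_rowsub_mx MB.
  by apply/matrixP => i j; rewrite !mxE.
have full1 : row_full (rowsub f M)^T by rewrite /row_full mxrank_tr.
pose g := fullrankfun full1.
have := minors0 f g.
suff : mxsub f g M \in unitmx by rewrite unitmxE unitfE => /eqP.
have -> : mxsub f g M = (rowsub g (rowsub f M)^T)^T by apply/matrixP => i j; rewrite !mxE.
rewrite unitmx_tr -row_full_unit.
exact: fullrowsub_full.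
Qed.

Lemma rank_le_retract (K : fieldType) m n s (M : 'M[K]_(m, n)) :
  (\rank M <= s)%N ->
  exists (A : 'M_(m, s)) (Q : 'M_(s, m)), A *m Q *m M = M.
Proof.
move=> les; have /row_fullP[Q QM] := col_base_full M.
(* [Q] is a left inverse of [col_base M]; the [pid_mx] factors pad the inner dimension from
   [\rank M] to [s]. *)
exists (col_base M *m pid_mx (\rank M)), (pid_mx (\rank M) *m Q).
rewrite mulmxA -[in _ *m pid_mx _ *m Q](mulmxA (col_base M)) pid_mx_id // pid_mx_1 mulmx1.
by rewrite -[M in _ *m M]mulmx_base mulmxA -(mulmxA _ Q) QM mulmx1 mulmx_base.
Qed.

(** * Composition and multilinearity of the action of matrices on tensors *)

Lemma tucker_mul (K : fieldType) N (d s r : 'I_N -> nat)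
    (A : forall i, 'M[K]_(d i, s i)) (B : forall i, 'M[K]_(s i, r i)) C :
  tucker A (tucker B C) = tucker (fun i => A i *m B i) C.
Proof.
apply/ffunP => j; rewrite !ffunE.
under eq_bigr => a _ do rewrite ffunE mulr_suml.
rewrite exchange_big; apply: eq_bigr => b _ /=.
under eq_bigr => a _ do rewrite -mulrA -big_split /=.
rewrite -mulr_sumr; congr (_ * _).
rewrite -(prod_sum_dffun (fun i c => B i c (b i) * A i (j i) c)).
by apply: eq_bigr => i _; rewrite mxE; apply: eq_bigr => c _; rewrite mulrC.
Qed.

Lemma tuckerZ (K : fieldType) N (d r : 'I_N -> nat)
    (A : forall i, 'M[K]_(d i, r i)) c C :
  tucker A (c *: C) = c *: tucker A C.
Proof.
apply/ffunP => j; rewrite !ffunE [RHS]mulr_sumr.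
by apply: eq_bigr => a _; rewrite ffunE mulrA.
Qed.

Lemma tucker_sum (K : fieldType) N (d r : 'I_N -> nat)
    (A : forall i, 'M[K]_(d i, r i)) m (C : 'I_m -> tensor K {dffun forall i, 'I_(r i)}) :
  tucker A (\sum_k C k) = \sum_k tucker A (C k).
Proof.
apply/ffunP => j; rewrite sum_ffunE !ffunE.
under eq_bigr => a _ do rewrite sum_ffunE mulr_suml.
by rewrite exchange_big; apply: eq_bigr => k _; rewrite ffunE.
Qed.

Lemma tucker_pure (K : fieldType) N (d r : 'I_N -> nat)
    (A : forall i, 'M[K]_(d i, r i)) (x : forall i, tensor K 'I_(r i)) :
  tucker A (pure x) = pure (fun i => [ffun b => \sum_c A i b c * x i c]).
Proof.
apply/ffunP => j; rewrite !ffunE.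
under [RHS]eq_bigr => i _ do rewrite ffunE.
rewrite (prod_sum_dffun (fun i c => A i (j i) c * x i c)).
by apply: eq_bigr => a _; rewrite ffunE -big_split; apply: eq_bigr => i _; rewrite mulrC.
Qed.

(** * Flattenings and the tensors fixed by matrices in each mode *)

Definition update N (d : 'I_N -> nat) (j : {dffun forall i, 'I_(d i)}) i (b : 'I_(d i)) :
  {dffun forall i, 'I_(d i)} := [ffun k => dfwith j b k].

Lemma update_id N (d : 'I_N -> nat) (j : {dffun forall i, 'I_(d i)}) i :
  update j (j i) = j.
Proof. by apply/ffunP => k; rewrite ffunE; case: dfwithP. Qed.

(* The columns are indexed by full multi-indices, whose i-th entry is ignored: this
   only repeats the columns of the usual flattening. *)
Definition flattening (K : fieldType) N (d : 'I_N -> nat)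
    (psi : tensor K {dffun forall i, 'I_(d i)}) i :
  'M[K]_(d i, #|{dffun forall i, 'I_(d i)}|) :=
  \matrix_(b, k) psi (update (enum_val k) b).

(** Grouping the core multi-indices by their i-th entry pulls [A i] out on the left, which bounds
    the rank by the inner dimension [r i]. *)
Lemma flattening_tucker (K : fieldType) N (d r : 'I_N -> nat)
    (A : forall i, 'M[K]_(d i, r i)) C i :
  flattening (tucker A C) i = A i *m \matrix_(c, k)
    \sum_(a : {dffun forall i, 'I_(r i)} | a i == c)
       C a * \prod_(l | l != i) A l ((enum_val k : {dffun forall i, 'I_(d i)}) l) (a l).
Proof.
apply/matrixP => b k; rewrite !mxE ffunE.
rewrite (partition_big (fun a : {dffun forall i, 'I_(r i)} => a i) xpredT) //=.
apply: eq_bigr => c _; rewrite mxE mulr_sumr; apply: eq_bigr => a /eqP <-.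
rewrite (bigD1 i) //= ffunE dfwith_in mulrCA; congr (_ * (_ * _)).
by apply: eq_bigr => l il; rewrite ffunE dfwith_out // eq_sym.
Qed.

Lemma rank_flattening_tucker (K : fieldType) N (d r : 'I_N -> nat)
    (A : forall i, 'M[K]_(d i, r i)) C i :
  (\rank (flattening (tucker A C) i) <= r i)%N.
Proof.
rewrite flattening_tucker.
exact: leq_trans (mxrankM_maxl _ _) (rank_leq_col _).
Qed.

(** Acting by [P] in mode [i] alone amounts to multiplying the i-th flattening by [P]: a multi-index
    differing from [j] in another mode meets an off-diagonal entry of an identity matrix. *)
Lemma tucker_single (K : fieldType) N (d : 'I_N -> nat) i (P : 'M[K]_(d i)) psi :
  P *m flattening psi i = flattening psi i ->
  tucker (dfwith (fun k => 1%:M : 'M[K]_(d k)) P) psi = psi.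
Proof.
move=> Ppsi; apply/ffunP => j; rewrite ffunE.
rewrite (partition_big (fun a : {dffun forall i, 'I_(d i)} => a i) xpredT) //=.
transitivity ((P *m flattening psi i) (j i) (enum_rank j)); last first.
  by rewrite Ppsi mxE enum_rankK update_id.
rewrite mxE; apply: eq_bigr => b _; rewrite mxE enum_rankK.
rewrite (bigD1 (update j b)) /=; last by rewrite ffunE dfwith_in.
rewrite (bigD1 i) //= ffunE !dfwith_in big1 ?mulr1 => [|k ki]; last first.
  by rewrite ffunE !dfwith_out ?mxE ?eqxx // eq_sym.
rewrite [X in _ + X]big1 ?addr0; first exact: mulrC.
move=> a /andP[/eqP ai neq].
have [k ajk] : exists k, a k != update j b k.
  apply/existsP; apply: contraNT neq; rewrite negb_exists => /forallP aj.
  by apply/eqP/ffunP => k; apply/eqP/negPn/aj.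
have ki : i != k by apply: contraNneq ajk => <-; rewrite ffunE dfwith_in ai.
rewrite (bigD1 k) //= dfwith_out // mxE eq_sym.
by move: ajk; rewrite ffunE dfwith_out // => /negPf->; rewrite mul0r mulr0.
Qed.

Lemma tucker_fixed (K : fieldType) N (d : 'I_N -> nat) (P : forall i, 'M[K]_(d i)) psi :
  (forall i, P i *m flattening psi i = flattening psi i) -> tucker P psi = psi.
Proof.
move=> Ppsi.
(* The modes are switched on one at a time. *)
pose Q (s : seq 'I_N) i : 'M[K]_(d i) := if i \in s then P i else 1%:M.
suff QE s : uniq s -> tucker (Q s) psi = psi.
  rewrite -[RHS](QE (enum 'I_N)) ?enum_uniq //.
  apply/ffunP => j; rewrite !ffunE; apply: eq_bigr => a _; congr (_ * _).
  by apply: eq_bigr => i _; rewrite /Q mem_enum.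
elim: s => [_ | i s IH /= /andP[is_ us]].
  (* [tucker_single] needs some mode, hence the separate case [N = 0]. *)
  case: (posnP N) => [N0 | N_gt0].
    apply/ffunP => j; rewrite ffunE.
    have uniqj (a : {dffun forall i, 'I_(d i)}) : a = j.
      by apply/ffunP => i; have := leq_trans (ltn_ord i) (eq_leq N0).
    rewrite (bigD1 j) //= [X in _ + X]big1 => [|a]; last by rewrite (uniqj a) eqxx.
    by rewrite big1 ?mulr1 ?addr0 // => i _; rewrite /Q in_nil mxE eqxx.
  rewrite -[RHS](@tucker_single _ _ _ (Ordinal N_gt0) 1%:M) ?mul1mx //.
  apply/ffunP => j; rewrite !ffunE; apply: eq_bigr => a _; congr (_ * _).
  by apply: eq_bigr => k _; rewrite /Q; case: dfwithP.
(* As [i] is not in [s], [Q s] is the identity in mode [i], so the composite there is [P i] and not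
   its square. *)
rewrite -[RHS](IH us) -{2}(tucker_single (Ppsi i)) tucker_mul.
apply/ffunP => j; rewrite !ffunE; apply: eq_bigr => a _; congr (_ * _).
apply: eq_bigr => k _; rewrite /Q inE eq_sym.
by case: dfwithP => [|{}k /negPf ik]; rewrite ?eqxx ?(negPf is_) ?ik ?mul1mx ?mulmx1.
Qed.

Lemma tucker_of_rank_flattening (K : fieldType) N (d r : 'I_N -> nat)
    (psi : tensor K {dffun forall i, 'I_(d i)}) :
  (forall i, \rank (flattening psi i) <= r i)%N ->
  exists (A : forall i, 'M[K]_(d i, r i)) C, psi = tucker A C.
Proof.
move=> rk.
(* The boolean equation lets [xchoose] select a pair for every mode. *)
have ex i : exists AQ : 'M[K]_(d i, r i) * 'M[K]_(r i, d i),
    AQ.1 *m AQ.2 *m flattening psi i == flattening psi i.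
  by have [A [Q]] := rank_le_retract (rk i); exists (A, Q); apply/eqP.
exists (fun i => (xchoose (ex i)).1), (tucker (fun i => (xchoose (ex i)).2) psi).
by rewrite tucker_mul tucker_fixed // => i; apply/eqP/(xchooseP (ex i)).
Qed.

(** * Tensors of the star-shaped network *)

Lemma vspace_retract (K : fieldType) m s (U : {vspace tensor K 'I_m}) :
  (\dim U <= s)%N ->
  exists (A : 'M[K]_(m, s)) (Q : 'M_(s, m)),
    forall x, x \in U -> [ffun b => \sum_c (A *m Q) b c * x c] = x.
Proof.
(* The columns of [M] are a basis of [U], so a matrix fixing [M] fixes all of [U]. *)
move=> les; pose M : 'M[K]_(m, \dim U) := \matrix_(b, k) (vbasis U)`_k b.
have [|A [Q AQM]] := @rank_le_retract _ _ _ s M.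
  exact: leq_trans (rank_leq_col _) les.
exists A, Q => x /coord_vbasis xE; apply/ffunP => b; rewrite ffunE.
have xM c : x c = \sum_k M c k * coord (vbasis U) k x.
  rewrite {1}xE sum_ffunE; apply: eq_bigr => k _.
  by rewrite ffunE mxE mulrC.
rewrite [RHS]xM; under eq_bigr => c _ do rewrite xM mulr_sumr.
rewrite exchange_big; apply: eq_bigr => k _ /=.
by rewrite -[in RHS]AQM [in RHS]mxE mulr_suml; apply: eq_bigr => c _; rewrite mulrA.
Qed.

Lemma tucker_of_in_tensor (K : fieldType) N (d r : 'I_N -> nat)
    (U : forall i, {vspace tensor K 'I_(d i)}) psi :
  (forall i, \dim (U i) <= r i)%N -> in_tensor U psi ->
  exists (A : forall i, 'M[K]_(d i, r i)) C, psi = tucker A C.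
Proof.
move=> dimU [m [c [x [xU psiE]]]].
(* Only the finitely many vectors [x k i] have to be fixed, which keeps the condition boolean for
   [xchoose]. *)
have /= ex i : exists AQ : 'M[K]_(d i, r i) * 'M[K]_(r i, d i),
    [forall k, [ffun b => \sum_c (AQ.1 *m AQ.2) b c * x k i c] == x k i].
  have [A [Q AQ]] := vspace_retract (dimU i).
  by exists (A, Q); apply/forallP => k; apply/eqP; exact: AQ (xU k i).
exists (fun i => (xchoose (ex i)).1), (tucker (fun i => (xchoose (ex i)).2) psi).
rewrite tucker_mul psiE tucker_sum; apply: eq_bigr => k _.
rewrite tuckerZ tucker_pure; congr (_ *: _).
apply/ffunP => j; rewrite !ffunE; apply: eq_bigr => i _.
by have /forallP/(_ k)/eqP-> := xchooseP (ex i).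
Qed.

Definition col_space (K : fieldType) m s (A : 'M[K]_(m, s)) : {vspace tensor K 'I_m} :=
  <<codom (fun c => [ffun b => A b c] : tensor K 'I_m)>>%VS.

Lemma dim_col_space (K : fieldType) m s (A : 'M[K]_(m, s)) :
  (\dim (col_space A) <= s)%N.
Proof. by apply: leq_trans (dim_span _) _; rewrite size_codom card_ord. Qed.

(** Each entry of the core weights one pure tensor, whose factors are columns of the [A i]. *)
Lemma in_tensor_tucker (K : fieldType) N (d r : 'I_N -> nat)
    (A : forall i, 'M[K]_(d i, r i)) C :
  in_tensor (fun i => col_space (A i)) (tucker A C).
Proof.
pose a (k : 'I_#|{dffun forall i, 'I_(r i)}|) : {dffun forall i, 'I_(r i)} := enum_val k.
exists #|{dffun forall i, 'I_(r i)}|, (fun k => C (a k)).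
exists (fun k i => [ffun b => A i b (a k i)]); split=> [k i|].
  by apply/memv_span/codomP; exists (a k i).
apply/ffunP => j; rewrite sum_ffunE ffunE.
rewrite (reindex_onto a enum_rank) => [|b _]; last exact: enum_rankK.
apply: eq_big => [k | k _]; first by rewrite /a enum_valK eqxx.
rewrite !ffunE; congr (_ * _).
by apply: eq_bigr => i _; rewrite ffunE.
Qed.

Lemma TTN_star (K : fieldType) N (N_gt0 : (0 < N)%N) (d r : 'I_N -> nat) :
  TTN K (star N_gt0 d r) = [set p | exists A C, is_class p (@tucker K N d r A C)]%classic.
Proof.
apply/seteqP; split=> p.
  move=> [U [[_ Utensor dimU] [psi ppsi psiU]]].
  have [A [C psiE]] := tucker_of_in_tensor dimU (Utensor psi psiU).
  by exists A, C; rewrite -psiE.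
move=> [A [C pAC]].
(* The bound at the root is 1, so the root space is the line itself. *)
exists (<[tucker A C]>%VS, fun i => col_space (A i)); split; last first.
  by exists (tucker A C) => //; exact: memv_line.
split=> [|w /vlineP[c ->]|i]; last exact: dim_col_space.
  by rewrite dim_vline; case: (_ != 0).
by rewrite -tuckerZ; exact: in_tensor_tucker.
Qed.

(** * Equations: minors of the flattenings of a generic tensor *)

Definition minor_poly (K : fieldType) N (d : 'I_N -> nat) i s
    (f : 'I_s -> 'I_(d i)) (g : 'I_s -> 'I_#|{dffun forall i, 'I_(d i)}|) :
  {mpoly K[#|{dffun forall i, 'I_(d i)}|]} :=
  \det (\matrix_(a, b) 'X_(enum_rank (update (enum_val (g b)) (f a)))).

Lemma minor_poly_homog (K : fieldType) N (d : 'I_N -> nat) i s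
    (f : 'I_s -> 'I_(d i)) g :
  @minor_poly K N d i s f g \is s.-homog.
Proof.
apply: rpred_sum => u _; rewrite -signr_odd mulr_sign.
set M := \matrix_(a, b) _.
(* Writing the degree as a sum of ones lets one induction run over the product and its degree
   together. *)
suff H : \prod_(a < s) M a (u a) \is (\sum_(a < s) 1)%N.-homog.
  by move: H; rewrite sum_nat_const card_ord muln1; case: ifP => _; rewrite ?rpredN.
elim/big_ind2: _ => [|P n Q m|a _]; [exact: dhomog1 | exact: dhomogM |].
by rewrite mxE dhomogX /= mdeg1.
Qed.

Lemma meval_minor_poly (K : fieldType) N (d : 'I_N -> nat) i s
    (f : 'I_s -> 'I_(d i)) g (psi : tensor K {dffun forall i, 'I_(d i)}) :
  (minor_poly K f g).@[coords psi] = \det (mxsub f g (flattening psi i)).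
Proof.
rewrite -det_map_mx; congr (\det _).
by apply/matrixP => a b; rewrite !mxE /= mevalXU /coords enum_rankK.
Qed.

Lemma is_class_scale (K : fieldType) (V : vectType K) (p : proj V) x y :
  is_class p x -> is_class p y -> exists c, y = c *: x.
Proof. by move=> [_ px] [_ py]; apply/vlineP; rewrite -px py memv_line. Qed.

Lemma is_class_exists (K : fieldType) (V : vectType K) (p : proj V) :
  exists x, is_class p x.
Proof.
have [x_nz x_in] : vpick (val p) != 0 /\ vpick (val p) \in val p.
  by rewrite vpick0 memv_pick -dimv_eq0 (eqP (valP p)).
exists (vpick (val p)); split=> //.
by apply/eqP; rewrite eq_sym eqEdim -memvE x_in dim_vline x_nz (eqP (valP p)).
Qed.

Lemma tucker_closed (K : fieldType) N (d r : 'I_N -> nat) :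
  zariski_closed [set p | exists A C, is_class p (@tucker K N d r A C)]%classic.
Proof.
exists [set q | exists i f g, q = @minor_poly K N d i (r i).+1 f g]%classic.
  by move=> _ [i [f [g ->]]]; exists (r i).+1; exact: minor_poly_homog.
apply/seteqP; split=> p.
  move=> [A [C pAC]] _ [i [f [g ->]]] x px.
  (* The equations are tested on every representative; the scalar is absorbed into the core. *)
  have [c ->] := is_class_scale pAC px.
  rewrite meval_minor_poly -tuckerZ.
  by apply (rank_le_minorsP _ _).1; exact: rank_flattening_tucker.
move=> minors0; have [x px] := is_class_exists p.
have [|A [C xE]] := @tucker_of_rank_flattening K N d r x.
  move=> i; apply/rank_le_minorsP => f g; rewrite -meval_minor_poly.
  by apply: minors0 px; exists i, f, g.
by exists A, C; rewrite -xE.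
Qed.

Theorem proposition2p11 (R : realType) (N : nat) (hN : (2 <= N)%N)
    (d r : 'I_N -> nat) (hd : forall i, (0 < d i)%N) (hr : forall i, (0 < r i)%N) :
  subspace_variety R[i] d r = TTN R[i] (star (ltnW hN) d r).
Proof. by rewrite TTN_star; exact/smallest_id/tucker_closed. Qed.
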